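(* Let $T_K$ be the integral operator with separable kernel $K(x,y)=\sum_{i=1}^N\sum_{j=1}^M a_{i,j}p_i(x)q_j(y)$ and weight $w$ on $\mathcal D$, acting on the functions of the form $f(x)=\sum_{i=1}^N c_ip_i(x)$ with $c_i\in\mathbb C$, and let $A$ and $B$ be the associated $N\times M$ and $M\times N$ matrices. Then the eigenvalues of $T_K$ coincide with the eigenvalues of the $N\times N$ matrix product $AB$. Moreover, the eigenfunctions $\phi$ of $T_K$ corresponding to an eigenvalue $\lambda$ can be expressed as $\phi(x)=\bm{p}(x)\bm{v}=\sum_{i=1}^N v_ip_i(x)$, where $\bm{v}=(v_1,\dots,v_N)^\top\in\mathbb C^N$ is an eigenvector of $AB$ corresponding to $\lambda$.
   Context: $\mathcal D\subset\mathbb R$ is a closed interval and $w$ is a weight function on $\mathcal D$. $p_1,\dots,p_N$ are linearly independent functions on $\mathcal D$, $q_1,\dots,q_M$ are linearly independent functions on $\mathcal D$, and $A=(a_{i,j})$ is an $N\times M$ matrix of scalars. The separable kernel is $K(x,y)=\sum_{i=1}^N\sum_{j=1}^M a_{i,j}p_i(x)q_j(y)$. The integral operator is $T_Kf(x)=\int_{\mathcal D}K(x,y)f(y)w(y)\,dy$, and it is assumed that all the integrals involved converge. Write $\langle f,q\rangle=\int_{\mathcal D}f(x)q(x)w(x)\,dx$ (no complex conjugation). $B$ is the $M\times N$ matrix whose entry in row $j$ and column $i$ is $\langle p_i,q_j\rangle$. $\bm{p}(x)=(p_1(x),\dots,p_N(x))$ is a row vector. The operator $T_K$ is considered on the space of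 functions of the form $\sum_{i=1}^N c_ip_i$ with $c_i\in\mathbb C$. A scalar $\lambda\in\mathbb C$ is an eigenvalue of $T_K$ with corresponding eigenfunction $\phi$ if $\phi$ is a nonzero function in this space and $T_K\phi=\lambda\phi$. *)

(* Defs.v *)
From HB Require Import structures.
From mathcomp Require Export all_boot all_order all_algebra.
From mathcomp Require Export all_classical all_reals all_analysis.
From mathcomp Require Export complex.

Set Implicit Arguments.
Unset Strict Implicit.
Unset Printing Implicit Defensive.

Import Order.TTheory GRing.Theory Num.Theory numFieldNormedType.Exports.

Local Open Scope classical_set_scope.
Local Open Scope ring_scope.
Local Open Scope complex_scope.

(* D may be unbounded: closed half-lines and the whole line are included. *)
Definition closed_interval (R : realType) (D : set R) : Prop :=
  is_interval D /\ closed D.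

Definition weight (R : realType) (D : set R) (w : R -> R) : Prop :=
  measurable_fun D w /\ (forall x, D x -> 0 <= w x).

(* Only the values on D count: functions are compared pointwise on D. *)
Definition lin_indep_on (R : realType) (D : set R) (n : nat)
    (f : 'I_n -> R -> R[i]) : Prop :=
  forall c : 'I_n -> R[i],
    (forall x, D x -> \sum_(i < n) c i * f i x = 0) -> forall i, c i = 0.

Definition cintegrable (R : realType) (D : set R) (f : R -> R[i]) : Prop :=
  (@lebesgue_measure R).-integrable D (fun x => (complex.Re (f x))%:E) /\
  (@lebesgue_measure R).-integrable D (fun x => (complex.Im (f x))%:E).

Definition cintegral (R : realType) (D : set R) (f : R -> R[i]) : R[i] :=
  (\int[@lebesgue_measure R]_(x in D) complex.Re (f x))%R +i*
  (\int[@lebesgue_measure R]_(x in D) complex.Im (f x))%R.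

(* Bilinear: there is no complex conjugation. *)
Definition pairing (R : realType) (D : set R) (w : R -> R)
    (f g : R -> R[i]) : R[i] :=
  cintegral D (fun x => f x * g x * (w x)%:C).

Definition sep_kernel (R : realType) (N M : nat)
    (p : 'I_N -> R -> R[i]) (q : 'I_M -> R -> R[i]) (A : 'M[R[i]]_(N, M))
    (x y : R) : R[i] :=
  \sum_(i < N) \sum_(j < M) A i j * p i x * q j y.

Definition int_op (R : realType) (D : set R) (w : R -> R)
    (K : R -> R -> R[i]) (f : R -> R[i]) (x : R) : R[i] :=
  cintegral D (fun y => K x y * f y * (w y)%:C).

Definition pairing_mx (R : realType) (D : set R) (w : R -> R) (N M : nat)
    (p : 'I_N -> R -> R[i]) (q : 'I_M -> R -> R[i]) : 'M[R[i]]_(M, N) :=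
  \matrix_(j < M, i < N) pairing D w (p i) (q j).

Definition in_span_on (R : realType) (D : set R) (n : nat)
    (f : 'I_n -> R -> R[i]) (phi : R -> R[i]) : Prop :=
  exists c : 'I_n -> R[i],
    forall x, D x -> phi x = \sum_(i < n) c i * f i x.

(* phi is an eigenfunction, for lambda, of T acting on the span of p over D. *)
Definition eigenfunction (R : realType) (D : set R) (n : nat)
    (p : 'I_n -> R -> R[i]) (T : (R -> R[i]) -> R -> R[i])
    (lambda : R[i]) (phi : R -> R[i]) : Prop :=
  [/\ in_span_on D p phi,
      exists2 x, D x & phi x != 0 &
      forall x, D x -> T phi x = lambda * phi x].

Definition op_eigenvalue (R : realType) (D : set R) (n : nat)
    (p : 'I_n -> R -> R[i]) (T : (R -> R[i]) -> R -> R[i])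
    (lambda : R[i]) : Prop :=
  exists phi, eigenfunction D p T lambda phi.

(* Column eigenvectors, whereas [eigenspace] is made of row vectors; the
   predicate [eigenvalue] is the same for both conventions. *)
Definition col_eigenvector (F : fieldType) (n : nat) (X : 'M[F]_n)
    (lambda : F) (v : 'cV[F]_n) : Prop :=
  v != 0 /\ X *m v = lambda *: v.

(* Main.v *)
Require Import Defs.
From mathcomp Require Import ring.

Set Implicit Arguments.
Unset Strict Implicit.
Unset Printing Implicit Defensive.

Import Order.TTheory GRing.Theory Num.Theory numFieldNormedType.Exports.

Local Open Scope classical_set_scope.
Local Open Scope ring_scope.
Local Open Scope complex_scope.

(** The theorem says that the map [v |-> p v], from coordinate vectors to
    functions on [D], intertwines the matrix [A B] with the operator [T].

    Pulling the finite sums of the kernel and of [phi = sum_k v_k p_k] out of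
    the integral gives
      [T phi (x) = sum_i p_i(x) sum_j a_ij sum_k <p_k, q_j> v_k
                 = sum_i (A B v)_i p_i(x)],
    which is [int_op_sep_kernel].  It rests on linearity of the complex
    Lebesgue integral ([cintegral_lincomb]), applied to the products
    [p_k q_j w], which are integrable by hypothesis.

    As the [p_i] are linearly independent on [D], a function of their span
    determines its coordinates, so [T phi = lambda phi] on [D] is equivalent
    to [A B v = lambda v], and [phi] vanishes on [D] only when [v = 0]; this
    is [eigenfunction_lincomb].  What remains is to pass from column
    eigenvectors to the predicate [eigenvalue], defined by row eigenvectors:
    a square matrix and its transpose have the same rank, hence the same
    eigenvalues ([col_eigenvalueP]). *)

Section ComplexIntegral.

Variables (R : realType) (D : set R).
(* The Lebesgue measure lives on [measurableTypeR R], whose display is not the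
   default one that [measurable D] would infer for a set of reals. *)
Hypothesis mD : @measurable _ (measurableTypeR R) D.

Implicit Types (f g : R -> R[i]) (c : R[i]).

Lemma cintegrable0 : cintegrable D (fun=> 0).
Proof. by split; exact: integrable0. Qed.

Lemma cintegral0 : cintegral D (fun=> 0) = 0.
Proof. by rewrite /cintegral /= Rintegral_cst// !mul0r. Qed.

Lemma eq_cintegral f g :
  (forall x, D x -> f x = g x) -> cintegral D f = cintegral D g.
Proof.
move=> fg; rewrite /cintegral.
by congr (_ +i* _); apply: eq_Rintegral => x /set_mem Dx; rewrite fg.
Qed.

Lemma cintegrableD f g : cintegrable D f -> cintegrable D g ->
  cintegrable D (fun x => f x + g x).
Proof.
move=> [fr fi] [gr gi]; split.
- apply: (eq_integrable mD _ _ _ (integrableD mD fr gr)) => x _ /=.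
  by case: (f x) (g x) => [? ?] [].
- apply: (eq_integrable mD _ _ _ (integrableD mD fi gi)) => x _ /=.
  by case: (f x) (g x) => [? ?] [].
Qed.

Lemma cintegralD f g : cintegrable D f -> cintegrable D g ->
  cintegral D (fun x => f x + g x) = cintegral D f + cintegral D g.
Proof.
move=> [fr fi] [gr gi]; rewrite /cintegral.
transitivity ((\int[@lebesgue_measure R]_(x in D)
    (complex.Re (f x) + complex.Re (g x)))%R +i*
  (\int[@lebesgue_measure R]_(x in D)
    (complex.Im (f x) + complex.Im (g x)))%R).
  by congr (_ +i* _); apply: eq_Rintegral => x _; case: (f x) (g x) => [? ?] [].
by rewrite !RintegralD.
Qed.

Lemma cintegrableZ c f : cintegrable D f -> cintegrable D (fun x => c * f x).
Proof.
case: c => a b [fr fi]; split.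
- apply: (eq_integrable mD _ _ _
    (integrableB mD (integrableZl mD a fr) (integrableZl mD b fi))) => x _ /=.
  by case: (f x).
- apply: (eq_integrable mD _ _ _
    (integrableD mD (integrableZl mD a fi) (integrableZl mD b fr))) => x _ /=.
  by case: (f x).
Qed.

Lemma cintegralZ c f : cintegrable D f ->
  cintegral D (fun x => c * f x) = c * cintegral D f.
Proof.
case: c => a b [fr fi]; rewrite /cintegral.
have Zl r h : (@lebesgue_measure R).-integrable D (EFin \o h) ->
    (@lebesgue_measure R).-integrable D (EFin \o (fun x => r * h x)).
  by move=> ih; apply: (eq_integrable mD _ _ _ (integrableZl mD r ih)).
transitivity ((\int[@lebesgue_measure R]_(x in D)
    (a * complex.Re (f x) - b * complex.Im (f x)))%R +i*
  (\int[@lebesgue_measure R]_(x in D)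
    (a * complex.Im (f x) + b * complex.Re (f x)))%R).
  by congr (_ +i* _); apply: eq_Rintegral => x _; case: (f x).
rewrite RintegralB//; [|exact: Zl|exact: Zl].
rewrite RintegralD//; [|exact: Zl|exact: Zl].
by rewrite !RintegralZl.
Qed.

(** Integrability and the value of the integral go through the same induction
    on the number of terms, since additivity of the integral asks for the
    integrability of the partial sums. *)
Lemma cintegral_lincomb (n : nat) (c : 'I_n -> R[i]) (f : 'I_n -> R -> R[i]) :
    (forall i, cintegrable D (f i)) ->
  cintegrable D (fun x => \sum_(i < n) c i * f i x) /\
  cintegral D (fun x => \sum_(i < n) c i * f i x) =
    \sum_(i < n) c i * cintegral D (f i).
Proof.
elim: n c f => [|n IHn] c f intf.
  have -> : (fun x => \sum_(i < 0) c i * f i x) = (fun=> 0).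
    by apply/funext => x; rewrite big_ord0.
  by rewrite big_ord0 cintegral0; split => //; exact: cintegrable0.
have -> : (fun x => \sum_(i < n.+1) c i * f i x) =
    (fun x => c ord0 * f ord0 x +
      \sum_(i < n) c (lift ord0 i) * f (lift ord0 i) x).
  by apply/funext => x; rewrite big_ord_recl.
have [intS eqS] :=
  IHn (fun i => c (lift ord0 i)) _ (fun i => intf (lift ord0 i)).
have intc := cintegrableZ (c ord0) (intf ord0).
split; first exact: cintegrableD.
by rewrite cintegralD// cintegralZ// eqS big_ord_recl.
Qed.

End ComplexIntegral.

Section SeparableKernel.

Variables (R : realType) (D : set R) (w : R -> R) (N M : nat).
Variables (p : 'I_N -> R -> R[i]) (q : 'I_M -> R -> R[i]).
Variable A : 'M[R[i]]_(N, M).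

Hypothesis mD : @measurable _ (measurableTypeR R) D.
Hypothesis intpq : forall (i : 'I_N) (j : 'I_M),
  cintegrable D (fun x => p i x * q j x * (w x)%:C).

Let T := int_op D w (sep_kernel p q A).
Let B := pairing_mx D w p q.

(** The operator acts on coordinates as the matrix [A B]: once the integrand
    is written as a combination of the products [p_k q_j w], with
    coefficients that may depend on [x] but not on the integration variable,
    the integrals that appear are the entries of [B]. *)
Lemma int_op_sep_kernel (v : 'cV[R[i]]_N) (phi : R -> R[i]) (x : R) :
    (forall y, D y -> phi y = \sum_(k < N) v k 0 * p k y) ->
  T phi x = \sum_(i < N) (A *m B *m v) i 0 * p i x.
Proof.
move=> phiE; rewrite /T /int_op.
transitivity (cintegral D (fun y => \sum_(j < M)
    (\sum_(i < N) A i j * p i x) *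
    (\sum_(k < N) v k 0 * (p k y * q j y * (w y)%:C)))).
  apply: eq_cintegral => y Dy; rewrite phiE// /sep_kernel exchange_big/=.
  rewrite !mulr_suml; apply: eq_bigr => j _.
  rewrite -mulr_suml -!mulrA; congr (_ * _).
  by rewrite mulrA mulr_sumr mulr_suml; apply: eq_bigr => k _; ring.
have intj j := cintegral_lincomb mD (fun k => v k 0) (intpq^~ j).
have [_ ->] := cintegral_lincomb mD (fun j => \sum_(i < N) A i j * p i x)
  (fun j => (intj j).1).
under eq_bigr => j _ do rewrite (intj j).2 mulr_suml.
rewrite exchange_big/=; apply: eq_bigr => i _.
rewrite -mulmxA mxE mulr_suml; apply: eq_bigr => j _.
rewrite mulrAC; congr (_ * _ * _); rewrite mxE; apply: eq_bigr => k _.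
by rewrite mxE mulrC.
Qed.

Hypothesis indp : lin_indep_on D p.

Lemma lin_indep_on_inj (u v : 'cV[R[i]]_N) :
    (forall x, D x ->
      \sum_(i < N) u i 0 * p i x = \sum_(i < N) v i 0 * p i x) ->
  u = v.
Proof.
move=> uv; apply/matrixP => i j; rewrite ord1; apply/eqP; rewrite -subr_eq0.
apply/eqP; move: i; apply: indp => x Dx.
under eq_bigr do rewrite mulrBl.
by rewrite sumrB uv// subrr.
Qed.

(** Coordinates with respect to the [p_i] are unique, so both the eigenvalue
    equation and the condition of not vanishing identically on [D] can be
    read off the coordinate vector. *)
Lemma eigenfunction_lincomb (lambda : R[i]) (v : 'cV[R[i]]_N)
    (phi : R -> R[i]) :
    (forall x, D x -> phi x = \sum_(i < N) v i 0 * p i x) ->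
  eigenfunction D p T lambda phi <-> col_eigenvector (A *m B) lambda v.
Proof.
move=> phiE; split=> [[_ [x Dx phix0] Tphi]|[v0 ABv]]; split.
- apply: contraNneq phix0 => v0; rewrite phiE// big1// => i _.
  by rewrite v0 mxE mul0r.
- apply: lin_indep_on_inj => y Dy.
  rewrite -(int_op_sep_kernel y phiE) Tphi// phiE// mulr_sumr.
  by apply: eq_bigr => i _; rewrite mxE mulrA.
- by exists (fun i => v i 0).
- apply: contrapT => phi0; move/eqP: v0; apply; apply: lin_indep_on_inj => x Dx.
  rewrite -phiE// big1 => [|i _]; last by rewrite mxE mul0r.
  by apply: contrapT => /eqP phix0; apply: phi0; exists x.
- move=> x Dx; rewrite (int_op_sep_kernel x phiE) ABv phiE// mulr_sumr.
  by apply: eq_bigr => i _; rewrite mxE mulrA.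
Qed.

End SeparableKernel.

(** The matrices [X - lambda] and [X^T - lambda] are transposes of each
    other, so they have the same rank; one has a nontrivial row kernel
    exactly when the other has. *)
Lemma eigenvalue_trmx (F : fieldType) (n : nat) (X : 'M[F]_n) (lambda : F) :
  eigenvalue X^T lambda = eigenvalue X lambda.
Proof.
rewrite /eigenvalue /eigenspace !kermx_eq0 /row_free -[in LHS]mxrank_tr.
by rewrite linearB/= trmxK tr_scalar_mx.
Qed.

Lemma col_eigenvalueP (F : fieldType) (n : nat) (X : 'M[F]_n) (lambda : F) :
  (exists v, col_eigenvector X lambda v) <-> eigenvalue X lambda.
Proof.
rewrite -eigenvalue_trmx; split=> [[v [v0 Xv]]|/eigenvalueP[u Xu u0]].
  by apply/eigenvalueP; exists v^T;
    rewrite ?trmx_eq0// -trmx_mul Xv linearZ.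
exists u^T; split; first by rewrite trmx_eq0.
by apply: trmx_inj; rewrite trmx_mul trmxK linearZ/= trmxK.
Qed.

Theorem theorem2p1 (R : realType) (D : set R) (w : R -> R) (N M : nat)
    (p : 'I_N -> R -> R[i]) (q : 'I_M -> R -> R[i]) (A : 'M[R[i]]_(N, M))
    (hD : closed_interval D) (hw : weight D w)
    (hp : lin_indep_on D p) (hq : lin_indep_on D q)
    (hint : forall (i : 'I_N) (j : 'I_M),
        cintegrable D (fun x => p i x * q j x * (w x)%:C)) :
  let T := int_op D w (sep_kernel p q A) in
  let B := pairing_mx D w p q in
  (forall lambda : R[i],
      op_eigenvalue D p T lambda <-> eigenvalue (A *m B) lambda) /\
  (forall (lambda : R[i]) (phi : R -> R[i]),
      eigenfunction D p T lambda phi ->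
      exists v : 'cV[R[i]]_N,
        col_eigenvector (A *m B) lambda v /\
        (forall x, D x -> phi x = \sum_(i < N) v i 0 * p i x)).
Proof.
move=> T B.
have mD : @measurable _ (measurableTypeR R) D.
  by case: hD => /measurable_realfun.is_interval_measurable.
have coords phi : in_span_on D p phi -> exists v : 'cV[R[i]]_N,
    forall x, D x -> phi x = \sum_(i < N) v i 0 * p i x.
  case=> c phiE; exists (\col_i c i) => x Dx; rewrite phiE//.
  by apply: eq_bigr => i _; rewrite mxE.
have eigen lambda phi : eigenfunction D p T lambda phi ->
    exists v : 'cV[R[i]]_N, col_eigenvector (A *m B) lambda v /\
      (forall x, D x -> phi x = \sum_(i < N) v i 0 * p i x).
  move=> Tphi; have [/coords[v phiE] _ _] := Tphi.
  by exists v; split => //; exact/(eigenfunction_lincomb A mD hint hp _ phiE).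
split=> // lambda; split=> [[phi /eigen[v [ABv _]]]|/col_eigenvalueP[v ABv]].
  by apply/col_eigenvalueP; exists v.
exists (fun x => \sum_(i < N) v i 0 * p i x).
by apply/(eigenfunction_lincomb A mD hint hp).
Qed.
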